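(* If $\mathcal{M}$ is a Type $\mathcal{A}$ model, then $\mathcal{M}$ is linearly equivalent to one of the models $\mathcal{M}_i^\nu(\cdot)$ listed in the context (for some admissible value of the parameters). Moreover, for every model $\mathcal{M}_i^\nu(\cdot)$ in the list (and all admissible values of the parameters), $\mathcal{Q}(\mathcal{M}_i^\nu(\cdot))=\mathcal{Q}_i^\nu(\cdot)$, and the Ricci tensor of $\mathcal{M}_i^\nu(\cdot)$ has rank $\nu$.
   Context: A Type $\mathcal{A}$ model is a pair $\mathcal{M}=(\mathbb{R}^2,\nabla)$ where $\nabla$ is a torsion free connection whose Christoffel symbols, $\nabla_{\partial_{x^i}}\partial_{x^j}=\Gamma_{ij}{}^k\partial_{x^k}$, $\Gamma_{ij}{}^k=\Gamma_{ji}{}^k$, are real constants in the standard coordinates. Write $\mathcal{M}(a,b,c,d,e,f)$ for the Type $\mathcal{A}$ model with $\Gamma_{11}{}^1=a$, $\Gamma_{11}{}^2=b$, $\Gamma_{12}{}^1=\Gamma_{21}{}^1=c$, $\Gamma_{12}{}^2=\Gamma_{21}{}^2=d$, $\Gamma_{22}{}^1=e$, $\Gamma_{22}{}^2=f$. Two Type $\mathcal{A}$ models are linearly equivalent if some element of $\operatorname{Gl}(2,\mathbb{R})$, acting as a linear change of variables on $\mathbb{R}^2$, intertwines the two connections. Curvature $R(\xi_1,\xi_2)=\nabla_{\xi_1}\nabla_{\xi_2}-\nabla_{\xi_2}\nabla_{\xi_1}-\nabla_{[\xi_1,\xi_2]}$; Ricci tensor $\rho(\xi_1,\xi_2)=\operatorname{Tr}\{\xi_3\mapsto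 R(\xi_3,\xi_1)\xi_2\}$, which is symmetric for Type $\mathcal{A}$ models. $\mathcal{Q}(\mathcal{M})$ is the space of smooth real functions $h$ on $\mathbb{R}^2$ satisfying $\partial_{x^i}\partial_{x^j}h-\Gamma_{ij}{}^k\partial_{x^k}h+h\,\rho_{ij}=0$ for all $i,j$. Let $\mathcal{S}(f_1,f_2,f_3)$ be the real span of the functions $f_1,f_2,f_3$, let $1$ be the constant function, and, for a function $u$, let $u\,\mathcal{S}(f_1,f_2,f_3)=\mathcal{S}(uf_1,uf_2,uf_3)$. All parameters are real, with $c_1\notin\{0,-1\}$, $c_2\neq0$, $c$ arbitrary. The list is: $\mathcal{M}_0^0=\mathcal{M}(0,0,0,0,0,0)$, $\mathcal{Q}_0^0=\mathcal{S}(1,x^1,x^2)$; $\mathcal{M}_1^0=\mathcal{M}(1,0,0,1,0,0)$, $\mathcal{Q}_1^0=\mathcal{S}(1,e^{x^1},x^2e^{x^1})$; $\mathcal{M}_2^0=\mathcal{M}(-1,0,0,0,0,1)$, $\mathcal{Q}_2^0=\mathcal{S}(1,e^{x^2},e^{-x^1})$; $\mathcal{M}_3^0=\mathcal{M}(0,0,0,0,0,1)$, $\mathcal{Q}_3^0=\mathcal{S}(1,x^1,e^{x^2})$; $\mathcal{M}_4^0=\mathcal{M}(0,0,0,0,1,0)$, $\mathcal{Q}_4^0=\mathcal{S}(1,x^2,(x^2)^2+2x^1)$; $\mathcal{M}_5^0=\mathcal{M}(1,0,0,1,-1,0)$, $\mathcal{Q}_5^0=\mathcal{S}(1,e^{x^1}\cos(x^2),e^{x^1}\sin(x^2))$;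 $\mathcal{M}_1^1=\mathcal{M}(-1,0,1,0,0,2)$, $\mathcal{Q}_1^1=e^{x^2}\mathcal{S}(1,x^2,e^{-x^1})$; $\mathcal{M}_2^1(c_1)=\mathcal{M}(-1,0,c_1,0,0,1+2c_1)$, $\mathcal{Q}_2^1(c_1)=e^{c_1x^2}\mathcal{S}(1,e^{x^2},e^{-x^1})$; $\mathcal{M}_3^1(c_1)=\mathcal{M}(0,0,c_1,0,0,1+2c_1)$, $\mathcal{Q}_3^1(c_1)=e^{c_1x^2}\mathcal{S}(1,e^{x^2},x^1)$; $\mathcal{M}_4^1(c)=\mathcal{M}(0,0,1,0,c,2)$, $\mathcal{Q}_4^1(c)=e^{x^2}\mathcal{S}(1,x^2,c(x^2)^2+2x^1)$; $\mathcal{M}_5^1(c)=\mathcal{M}(1,0,0,0,1+c^2,2c)$, $\mathcal{Q}_5^1(c)=\mathcal{S}(e^{cx^2}\cos(x^2),e^{cx^2}\sin(x^2),e^{x^1})$; $\mathcal{M}_1^2(a_1,a_2)=\mathcal{M}\left(\frac{a_1^2+a_2-1}{D},\frac{a_1^2-a_1}{D},\frac{a_1a_2}{D},\frac{a_1a_2}{D},\frac{a_2^2-a_2}{D},\frac{a_1+a_2^2-1}{D}\right)$ with $D=a_1+a_2-1$, $\mathcal{Q}_1^2(a_1,a_2)=\mathcal{S}(e^{x^1},e^{x^2},e^{a_1x^1+a_2x^2})$, for $a_1a_2\neq0$ and $a_1+a_2\neq1$; $\mathcal{M}_2^2(b_1,b_2)=\mathcal{M}\left(1+b_1,0,b_2,1,\frac{1+b_2^2}{b_1-1},0\right)$,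 $\mathcal{Q}_2^2(b_1,b_2)=\mathcal{S}(e^{x^1}\cos(x^2),e^{x^1}\sin(x^2),e^{b_1x^1+b_2x^2})$, for $b_1\neq1$ and $(b_1,b_2)\neq(0,0)$; $\mathcal{M}_3^2(c_2)=\mathcal{M}(2,0,0,1,c_2,1)$, $\mathcal{Q}_3^2(c_2)=e^{x^1}\mathcal{S}(1,x^1-c_2x^2,e^{x^2})$; $\mathcal{M}_4^2(\pm1)=\mathcal{M}(2,0,0,1,\pm1,0)$, $\mathcal{Q}_4^2(\pm1)=\mathcal{S}(e^{x^1},x^2e^{x^1},(2x^1\pm(x^2)^2)e^{x^1})$ (same sign throughout). *)

(* Defs.v *)
(* Affine connections on the plane, over an arbitrary [R : realType].
   Points and tangent vectors of the plane are row vectors ['rV[R]_2]; the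
   coordinate x^1 has index 0 and x^2 has index 1. *)
From HB Require Import structures.
From mathcomp Require Import all_boot all_order all_algebra.
From mathcomp Require Import boolp classical_sets reals topology normedtype.
From mathcomp Require Import derive sequences exp trigo.

Set Implicit Arguments.
Unset Strict Implicit.
Unset Printing Implicit Defensive.

Import Order.TTheory GRing.Theory Num.Theory.
Import numFieldNormedType.Exports.

Local Open Scope classical_set_scope.
Local Open Scope ring_scope.

Definition xcoord (R : realType) (k : 'I_2) (p : 'rV[R]_2) : R := p ord0 k.
Definition x1 (R : realType) (p : 'rV[R]_2) : R := xcoord 0 p.
Definition x2 (R : realType) (p : 'rV[R]_2) : R := xcoord 1 p.

Definition unit_vec (R : realType) (i : 'I_2) : 'rV[R]_2 := delta_mx ord0 i.

Definition partial (R : realType) (i : 'I_2) (f : 'rV[R]_2 -> R) :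
    'rV[R]_2 -> R :=
  fun p => 'D_(unit_vec R i) f p.

(* C^infinity: every iterated partial derivative (the empty list gives [f]
   itself) is Frechet differentiable, hence continuous, at every point. *)
Definition smooth (R : realType) (f : 'rV[R]_2 -> R) : Prop :=
  forall (s : seq 'I_2) (p : 'rV[R]_2),
    differentiable (foldr (@partial R) f s) p.

Definition vector_field (R : realType) : Type := 'rV[R]_2 -> 'rV[R]_2.

Definition comp_vf (R : realType) (X : vector_field R) (k : 'I_2) :
    'rV[R]_2 -> R :=
  fun p => xcoord k (X p).

Definition smooth_vf (R : realType) (X : vector_field R) : Prop :=
  forall k : 'I_2, smooth (comp_vf X k).

Definition coord_vf (R : realType) (i : 'I_2) : vector_field R :=
  fun _ => unit_vec R i.

Definition deriv_along (R : realType) (X : vector_field R)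
    (f : 'rV[R]_2 -> R) : 'rV[R]_2 -> R :=
  fun p => 'D_(X p) f p.

Definition add_vf (R : realType) (X Y : vector_field R) : vector_field R :=
  fun p => X p + Y p.

Definition scale_vf (R : realType) (f : 'rV[R]_2 -> R) (X : vector_field R) :
    vector_field R :=
  fun p => f p *: X p.

Definition lie_bracket (R : realType) (X Y : vector_field R) :
    vector_field R :=
  fun p => \row_k (deriv_along X (comp_vf Y k) p
                   - deriv_along Y (comp_vf X k) p).

(* A connection is an operator [nabla X Y] on vector fields. For convenience it
   is a total operator on arbitrary maps; only its values on smooth vector
   fields are constrained or used. *)
Definition operator (R : realType) : Type :=
  vector_field R -> vector_field R -> vector_field R.

Record affine_connection (R : realType) (nabla : operator R) : Prop :=
  AffineConnection {
    nabla_smooth : forall X Y : vector_field R,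
      smooth_vf X -> smooth_vf Y -> smooth_vf (nabla X Y);
    nabla_addl : forall X X' Y : vector_field R,
      smooth_vf X -> smooth_vf X' -> smooth_vf Y ->
      nabla (add_vf X X') Y = add_vf (nabla X Y) (nabla X' Y);
    nabla_scalel : forall (f : 'rV[R]_2 -> R) (X Y : vector_field R),
      smooth f -> smooth_vf X -> smooth_vf Y ->
      nabla (scale_vf f X) Y = scale_vf f (nabla X Y);
    nabla_addr : forall X Y Y' : vector_field R,
      smooth_vf X -> smooth_vf Y -> smooth_vf Y' ->
      nabla X (add_vf Y Y') = add_vf (nabla X Y) (nabla X Y');
    nabla_leibniz : forall (f : 'rV[R]_2 -> R) (X Y : vector_field R),
      smooth f -> smooth_vf X -> smooth_vf Y ->
      nabla X (scale_vf f Y)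
      = add_vf (scale_vf (deriv_along X f) Y) (scale_vf f (nabla X Y))
  }.

Definition torsion_free (R : realType) (nabla : operator R) : Prop :=
  forall (X Y : vector_field R) (p : 'rV[R]_2),
    smooth_vf X -> smooth_vf Y ->
    nabla X Y p - nabla Y X p = lie_bracket X Y p.

Definition christoffel (R : realType) (nabla : operator R) (i j k : 'I_2) :
    'rV[R]_2 -> R :=
  comp_vf (nabla (coord_vf i) (coord_vf j)) k.

Record typeA_model (R : realType) (nabla : operator R) : Prop := TypeAModel {
  typeA_connection : affine_connection nabla;
  typeA_torsion_free : torsion_free nabla;
  typeA_constant : exists Gamma : 'I_2 -> 'I_2 -> 'I_2 -> R,
    forall (i j k : 'I_2) (p : 'rV[R]_2),
      christoffel nabla i j k p = Gamma i j k
}.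

Definition curvature (R : realType) (nabla : operator R)
    (X Y Z : vector_field R) : vector_field R :=
  fun p => nabla X (nabla Y Z) p - nabla Y (nabla X Z) p
           - nabla (lie_bracket X Y) Z p.

(* The trace of xi |-> R(xi, X)Y, read in the coordinate frame: row [k] of the
   matrix is the image of the k-th coordinate field. *)
Definition ricci (R : realType) (nabla : operator R) (X Y : vector_field R) :
    'rV[R]_2 -> R :=
  fun p => \tr (\matrix_(k < 2, l < 2)
                  xcoord l (curvature nabla (coord_vf k) X Y p)).

Definition ricci_mx (R : realType) (nabla : operator R) (p : 'rV[R]_2) :
    'M[R]_2 :=
  \matrix_(i < 2, j < 2) ricci nabla (coord_vf i) (coord_vf j) p.

Definition ricci_has_rank (R : realType) (nabla : operator R) (r : nat) :
    Prop :=
  forall p : 'rV[R]_2, \rank (ricci_mx nabla p) = r.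

Definition Qspace (R : realType) (nabla : operator R) :
    set ('rV[R]_2 -> R) :=
  [set h | smooth h /\
     forall (i j : 'I_2) (p : 'rV[R]_2),
       partial i (partial j h) p
       - \sum_(k < 2) christoffel nabla i j k p * partial k h p
       + h p * ricci_mx nabla p i j = 0].

(* The linear change of variables with matrix [T] is p |-> p *m T. *)
Definition pushforward (R : realType) (T : 'M[R]_2) (X : vector_field R) :
    vector_field R :=
  fun p => X (p *m invmx T) *m T.

Definition linearly_equivalent (R : realType) (nabla nabla' : operator R) :
    Prop :=
  exists2 T : 'M[R]_2, T \in unitmx &
    forall X Y : vector_field R, smooth_vf X -> smooth_vf Y ->
      nabla' (pushforward T X) (pushforward T Y)
      = pushforward T (nabla X Y).

(* Symmetric in [i] and [j]: a, b for (1,1); c, d for (1,2) and (2,1);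
   e, f for (2,2). *)
Definition Gamma_of (R : realType) (a b c d e f : R) (i j k : 'I_2) : R :=
  if (i == 0) && (j == 0) then (if k == 0 then a else b)
  else if (i == 1) && (j == 1) then (if k == 0 then e else f)
  else (if k == 0 then c else d).

Definition calM (R : realType) (a b c d e f : R) : operator R :=
  fun X Y p =>
    \row_k (deriv_along X (comp_vf Y k) p
            + \sum_(i < 2) \sum_(j < 2)
                comp_vf X i p * comp_vf Y j p * Gamma_of a b c d e f i j k).

Definition span3 (R : realType) (f1 f2 f3 : 'rV[R]_2 -> R) :
    set ('rV[R]_2 -> R) :=
  [set h | exists k1 k2 k3 : R,
     h = fun p => k1 * f1 p + k2 * f2 p + k3 * f3 p].

Definition mul_span3 (R : realType) (u f1 f2 f3 : 'rV[R]_2 -> R) :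
    set ('rV[R]_2 -> R) :=
  span3 (fun p => u p * f1 p) (fun p => u p * f2 p) (fun p => u p * f3 p).

(* [Mi_nu] names the model M_i^nu; the sign of M_4^2 is a real equal to 1 or
   to -1. *)
Inductive model_name (R : realType) : Type :=
| M0_0 | M1_0 | M2_0 | M3_0 | M4_0 | M5_0
| M1_1
| M2_1 (c1 : R)
| M3_1 (c1 : R)
| M4_1 (c : R)
| M5_1 (c : R)
| M1_2 (a1 a2 : R)
| M2_2 (b1 b2 : R)
| M3_2 (c2 : R)
| M4_2 (s : R).

Arguments M0_0 {R}.
Arguments M1_0 {R}.
Arguments M2_0 {R}.
Arguments M3_0 {R}.
Arguments M4_0 {R}.
Arguments M5_0 {R}.
Arguments M1_1 {R}.

Definition admissible (R : realType) (m : model_name R) : Prop :=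
  match m with
  | M2_1 c1 | M3_1 c1 => c1 <> 0 /\ c1 <> -1
  | M1_2 a1 a2 => a1 * a2 <> 0 /\ a1 + a2 <> 1
  | M2_2 b1 b2 => b1 <> 1 /\ (b1, b2) <> (0, 0)
  | M3_2 c2 => c2 <> 0
  | M4_2 s => s = 1 \/ s = -1
  | _ => True
  end.

Definition model (R : realType) (m : model_name R) : operator R :=
  match m with
  | M0_0 => calM 0 0 0 0 0 0
  | M1_0 => calM 1 0 0 1 0 0
  | M2_0 => calM (-1) 0 0 0 0 1
  | M3_0 => calM 0 0 0 0 0 1
  | M4_0 => calM 0 0 0 0 1 0
  | M5_0 => calM 1 0 0 1 (-1) 0
  | M1_1 => calM (-1) 0 1 0 0 2
  | M2_1 c1 => calM (-1) 0 c1 0 0 (1 + 2 * c1)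
  | M3_1 c1 => calM 0 0 c1 0 0 (1 + 2 * c1)
  | M4_1 c => calM 0 0 1 0 c 2
  | M5_1 c => calM 1 0 0 0 (1 + c ^+ 2) (2 * c)
  | M1_2 a1 a2 =>
      let D := a1 + a2 - 1 in
      calM ((a1 ^+ 2 + a2 - 1) / D) ((a1 ^+ 2 - a1) / D)
        (a1 * a2 / D) (a1 * a2 / D)
        ((a2 ^+ 2 - a2) / D) ((a1 + a2 ^+ 2 - 1) / D)
  | M2_2 b1 b2 => calM (1 + b1) 0 b2 1 ((1 + b2 ^+ 2) / (b1 - 1)) 0
  | M3_2 c2 => calM 2 0 0 1 c2 1
  | M4_2 s => calM 2 0 0 1 s 0
  end.

Definition Qlist (R : realType) (m : model_name R) : set ('rV[R]_2 -> R) :=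
  match m with
  | M0_0 => span3 (fun=> 1) (@x1 R) (@x2 R)
  | M1_0 => span3 (fun=> 1) (fun p => expR (x1 p))
                  (fun p => x2 p * expR (x1 p))
  | M2_0 => span3 (fun=> 1) (fun p => expR (x2 p)) (fun p => expR (- x1 p))
  | M3_0 => span3 (fun=> 1) (@x1 R) (fun p => expR (x2 p))
  | M4_0 => span3 (fun=> 1) (@x2 R) (fun p => x2 p ^+ 2 + 2 * x1 p)
  | M5_0 => span3 (fun=> 1) (fun p => expR (x1 p) * cos (x2 p))
                  (fun p => expR (x1 p) * sin (x2 p))
  | M1_1 => mul_span3 (fun p => expR (x2 p))
                      (fun=> 1) (@x2 R) (fun p => expR (- x1 p))
  | M2_1 c1 => mul_span3 (fun p => expR (c1 * x2 p))
                 (fun=> 1) (fun p => expR (x2 p)) (fun p => expR (- x1 p))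
  | M3_1 c1 => mul_span3 (fun p => expR (c1 * x2 p))
                 (fun=> 1) (fun p => expR (x2 p)) (@x1 R)
  | M4_1 c => mul_span3 (fun p => expR (x2 p))
                (fun=> 1) (@x2 R) (fun p => c * x2 p ^+ 2 + 2 * x1 p)
  | M5_1 c => span3 (fun p => expR (c * x2 p) * cos (x2 p))
                    (fun p => expR (c * x2 p) * sin (x2 p))
                    (fun p => expR (x1 p))
  | M1_2 a1 a2 => span3 (fun p => expR (x1 p)) (fun p => expR (x2 p))
                        (fun p => expR (a1 * x1 p + a2 * x2 p))
  | M2_2 b1 b2 => span3 (fun p => expR (x1 p) * cos (x2 p))
                        (fun p => expR (x1 p) * sin (x2 p))
                        (fun p => expR (b1 * x1 p + b2 * x2 p))
  | M3_2 c2 => mul_span3 (fun p => expR (x1 p))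
                 (fun=> 1) (fun p => x1 p - c2 * x2 p) (fun p => expR (x2 p))
  | M4_2 s => span3 (fun p => expR (x1 p)) (fun p => x2 p * expR (x1 p))
                    (fun p => (2 * x1 p + s * x2 p ^+ 2) * expR (x1 p))
  end.

Definition nu (R : realType) (m : model_name R) : nat :=
  match m with
  | M0_0 | M1_0 | M2_0 | M3_0 | M4_0 | M5_0 => 0%N
  | M1_1 | M2_1 _ | M3_1 _ | M4_1 _ | M5_1 _ => 1%N
  | M1_2 _ _ | M2_2 _ _ | M3_2 _ | M4_2 _ => 2%N
  end.

(* Main.v *)
(* Write a Type A connection as a symmetric bilinear product on R^2. Flatness of
   the system defining Q makes B = R 1 + R^2, with x y = Gamma(x, y) - rho(x, y) 1,
   a commutative associative algebra of dimension 3, so models up to linear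
   equivalence are pairs of such an algebra and a complement of the line R 1.
   Either every x is an eigenvector of its square, and then Gamma is explicit, or
   some t in R^2 has t, Gamma(t, t) independent and B = R[t]/(cubic); in the basis
   1, t, t^2 - s the model depends only on the cubic and on s. The factorization
   type of the cubic and the vanishing of the weights at its roots of the linear
   form with kernel R^2 then single out one family of the list.

   A solution of the equations of Q satisfies, together with its first partial
   derivatives, a linear first-order ODE along each line through the origin, so
   it vanishes if its 1-jet at the origin does; hence dim Q <= 3 and it suffices
   to exhibit three solutions with independent 1-jets. *)
Require Import Defs.
From HB Require Import structures.
From mathcomp Require Import all_boot all_order all_algebra.
From mathcomp Require Import boolp classical_sets functions reals topology normedtype.
From mathcomp Require Import derive sequences exp trigo.
From mathcomp Require Import ring lra.

Set Implicit Arguments.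
Unset Strict Implicit.
Unset Printing Implicit Defensive.

Import Order.TTheory GRing.Theory Num.Theory.
Import numFieldNormedType.Exports.

Local Open Scope classical_set_scope.
Local Open Scope ring_scope.

(** * Elementary functions are smooth *)

(** A syntax of elementary functions closed under partial derivatives: smoothness becomes
    structural, and the equations of Q become identities within reach of [ring] and [field]. *)
Inductive term (R : realType) : Type :=
| TConst (r : R)
| TCoord (k : 'I_2)
| TAdd (s t : term R)
| TMul (s t : term R)
| TOpp (t : term R)
| TExp (t : term R)
| TCos (t : term R)
| TSin (t : term R).

Fixpoint teval (R : realType) (t : term R) : 'rV[R]_2 -> R :=
  match t with
  | TConst r => fun=> r
  | TCoord k => xcoord k
  | TAdd s t => fun p => teval s p + teval t p
  | TMul s t => fun p => teval s p * teval t p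
  | TOpp t => fun p => - teval t p
  | TExp t => fun p => expR (teval t p)
  | TCos t => fun p => cos (teval t p)
  | TSin t => fun p => sin (teval t p)
  end.

Fixpoint tpartial (R : realType) (i : 'I_2) (t : term R) : term R :=
  match t with
  | TConst r => TConst 0
  | TCoord k => TConst (i == k)%:R
  | TAdd s t => TAdd (tpartial i s) (tpartial i t)
  | TMul s t => TAdd (TMul s (tpartial i t)) (TMul (tpartial i s) t)
  | TOpp t => TOpp (tpartial i t)
  | TExp t => TMul (TExp t) (tpartial i t)
  | TCos t => TMul (TMul (TConst (-1)) (TSin t)) (tpartial i t)
  | TSin t => TMul (TCos t) (tpartial i t)
  end.

Section ChainRule.
Variables (R : realType) (V : normedModType R).

Lemma differentiable_comp1 (g : R -> R) (f : V -> R) (p : V) :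
  differentiable f p -> derivable g (f p) 1 ->
  differentiable (fun x => g (f x)) p.
Proof.
move=> df /derivable1_diffP dg.
exact: (@differentiable_comp _ _ _ _ f g).
Qed.

Lemma derive_comp1 (g : R -> R) (f : V -> R) (p v : V) :
  differentiable f p -> derivable g (f p) 1 ->
  'D_v (fun x => g (f x)) p = 'D_1 g (f p) * 'D_v f p.
Proof.
move=> df dg; have dg' := dg; move/derivable1_diffP: dg => dg.
have dgf := differentiable_comp1 df dg'.
rewrite (deriveE v dgf) (deriveE v df) (deriveE (1 : R) dg).
rewrite (_ : (fun x => g (f x)) = g \o f) // diff_comp //=.
by rewrite -[X in 'd g _ X]mulr1 linearZ /= mulrC.
Qed.

End ChainRule.

Section Terms.
Variable R : realType.
Implicit Types (t : term R) (p : 'rV[R]_2).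

Lemma teval_differentiable t p : differentiable (teval t) p.
Proof.
elim: t => [r|k|s hs t ht|s hs t ht|t ht|t ht|t ht|t ht] /=.
- exact: differentiable_cst.
- exact: differentiable_coord.
- exact: differentiableD.
- exact: differentiableM.
- exact: differentiableN.
- exact: differentiable_comp1.
- exact: differentiable_comp1.
- exact: differentiable_comp1.
Qed.

Lemma derive_xcoord (k : 'I_2) (v p : 'rV[R]_2) : 'D_v (@xcoord R k) p = xcoord k v.
Proof.
have h : differentiable (@xcoord R k) p by exact: differentiable_coord.
rewrite deriveE //.
(* The coordinate is bundled as a linear map, which is its own differential. *)
pose f : 'rV[R]_2 -> R := fun x => x ord0 k.
have lf : linear f by move=> a u w; rewrite /f !mxE.
pose F : {linear 'rV[R]_2 -> R} := HB.pack f (GRing.isLinear.Build _ _ _ _ f lf).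
have -> : @xcoord R k = F by [].
by rewrite diff_lin //; exact: coord_continuous.
Qed.

Lemma partial_teval (i : 'I_2) t : partial i (teval t) = teval (tpartial i t).
Proof.
apply/funext => p; rewrite /partial.
elim: t => [r|k|s hs t ht|s hs t ht|t ht|t ht|t ht|t ht] /=.
- exact: derive_cst.
- by rewrite derive_xcoord /xcoord /unit_vec mxE eqxx /= eq_sym.
- by rewrite -hs -ht; apply: deriveD; exact/diff_derivable/teval_differentiable.
- rewrite -hs -ht [X in _ + X]mulrC.
  by apply: deriveM; exact/diff_derivable/teval_differentiable.
- by rewrite -ht; apply: deriveN; exact/diff_derivable/teval_differentiable.
- rewrite derive_comp1 -?ht //; last exact: teval_differentiable.
  by rewrite derive_val.
- rewrite derive_comp1 -?ht //; last exact: teval_differentiable.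
  by rewrite derive_val mulN1r.
- rewrite derive_comp1 -?ht //; last exact: teval_differentiable.
  by rewrite derive_val.
Qed.

Lemma teval_smooth t : smooth (teval t).
Proof.
move=> s p.
suff [u ->] : exists u, foldr (@partial R) (teval t) s = teval u.
  exact: teval_differentiable.
elim: s => [|i s [u hu]] /=; first by exists t.
by exists (tpartial i u); rewrite hu partial_teval.
Qed.

End Terms.

(** * Uniqueness for linear systems *)

Section LinearSystem.
Variables (R : realType) (n : nat) (A : 'M[R]_n) (y : 'I_n -> R -> R).
Hypothesis dy : forall i (t : R), is_derive t 1 (y i) (\sum_j A i j * y j t).

(** Gronwall's argument: the energy [E], the sum of the squares, satisfies E' <= C E, so exp(-C t)
    E(t) does not increase from its value 0 at t = 0. *)
Lemma linear_system_zero : (forall i, y i 0 = 0) -> forall i, y i 1 = 0.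
Proof.
move=> y0.
pose C := \sum_i \sum_j 2 * `|A i j|.
pose E t := \sum_i y i t ^+ 2.
pose dE t := \sum_i 2 * y i t * (\sum_j A i j * y j t).
have E_ge i t : y i t ^+ 2 <= E t.
  by rewrite /E (bigD1 i) //= lerDl sumr_ge0 // => k _; exact: sqr_ge0.
have HE (t : R) : is_derive t 1 E (dE t).
  move: (is_derive_sum (fun i => is_deriveM (dy i t) (dy i t))).
  set S := (X in is_derive _ _ X _) => h.
  have -> : E = S :> (R -> R).
    by apply/funext => u; rewrite /S fct_sumE; apply: eq_bigr => i _; rewrite expr2.
  apply: is_derive_eq.
  by apply: eq_bigr => i _; rewrite /GRing.scale /=; ring.
have dE_le t : dE t <= C * E t.
  rewrite /dE /C mulr_suml ler_sum // => i _.
  rewrite mulr_sumr mulr_suml ler_sum // => j _.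
  have := E_ge i t; have := E_ge j t.
  set u := y i t; set v := y j t; set a := A i j => hv hu.
  have huv : `|u * v| <= E t.
    rewrite ler_norml; apply/andP; split.
      by have := sqr_ge0 (u + v); nra.
    by have := sqr_ge0 (u - v); nra.
  have -> : 2 * u * (a * v) = 2 * (a * (u * v)) by ring.
  rewrite -mulrA ler_pM2l // (le_trans (ler_norm _)) // normrM.
  exact: ler_wpM2l.
pose F t := expR (- C * t) * E t.
have HF (t : R) : is_derive t 1 F (expR (- C * t) * (dE t - C * E t)).
  have h1 : is_derive t (1 : R) (fun s : R => - C * s) (- C).
    have := @is_deriveZ _ _ _ id (- C) t 1 _ (is_derive_id _ _).
    by move=> h; apply: is_derive_eq; rewrite scaler1.
  have h2 : is_derive t 1 (fun s => expR (- C * s)) (- C * expR (- C * t)).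
    have d1 : differentiable (fun s : R => - C * s) t.
      exact/derivable1_diffP/(@ex_derive _ _ _ _ _ _ _ h1).
    have dexp : derivable expR (- C * t) 1 by exact: derivable_expR.
    split; first exact/derivable1_diffP/differentiable_comp1.
    by rewrite (@derive_comp1 _ _ expR) // !derive_val mulrC.
  have := is_deriveM h2 (HE t).
  by move=> h; apply: is_derive_eq; rewrite /GRing.scale /=; ring.
have F_le : F 1 <= F 0.
  apply: (@ler0_derive1_nincr _ F 0 1) => //.
  - by move=> x _; rewrite derive1E derive_val pmulr_rle0 ?expR_gt0 // subr_le0.
  - apply: derivable_within_continuous => x _; exact: ex_derive.
have E0 : E 1 <= 0.
  have F0 : F 0 = 0.
    by rewrite /F /E big1 ?mulr0 // => i _; rewrite y0 expr0n.
  by move: F_le; rewrite F0 /F pmulr_rle0 // expR_gt0.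
move=> i; apply/eqP; rewrite -sqrf_eq0 eq_le sqr_ge0 andbT.
exact: le_trans (E_ge i 1) E0.
Qed.

End LinearSystem.

(** * Calculus of smooth functions on the plane *)

Section SmoothFunctions.
Variable R : realType.
Implicit Types (f g h : 'rV[R]_2 -> R) (p v : 'rV[R]_2).

Lemma smooth_differentiable f p : smooth f -> differentiable f p.
Proof. by move=> /(_ [::] p). Qed.

Lemma smooth_derivable f p v : smooth f -> derivable f p v.
Proof. by move=> hf; exact/diff_derivable/smooth_differentiable. Qed.

Lemma smooth_partial (i : 'I_2) f : smooth f -> smooth (partial i f).
Proof. by move=> hf s p; have := hf (rcons s i) p; rewrite foldr_rcons. Qed.

Lemma derive_lincomb (a b : R) f g p v : smooth f -> smooth g ->
  'D_v (fun x => a * f x + b * g x) p = a * 'D_v f p + b * 'D_v g p.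
Proof.
move=> /smooth_derivable df /smooth_derivable dg.
have -> : (fun x => a * f x + b * g x) = (a \*: f) + (b \*: g) by [].
by rewrite deriveD ?deriveZ //; exact: derivableZ.
Qed.

Lemma smooth_lincomb (a b : R) f g : smooth f -> smooth g ->
  smooth (fun x => a * f x + b * g x).
Proof.
move=> hf hg s p.
have iter_smooth h s1 : smooth h -> smooth (foldr (@partial R) h s1).
  by move=> hh s' q; rewrite -foldr_cat; exact: hh.
suff -> : foldr (@partial R) (fun x => a * f x + b * g x) s =
    (a \*: foldr (@partial R) f s) + (b \*: foldr (@partial R) g s).
  by apply: differentiableD; apply: differentiableZ; exact: (iter_smooth _ _ _ [::]).
elim: s {p} => [//|i s ih] /=.
rewrite ih //; apply/funext => p.
exact: (derive_lincomb a b p (unit_vec R i) (iter_smooth _ s hf) (iter_smooth _ s hg)).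
Qed.

Lemma smooth_cst (a : R) : smooth (fun=> a).
Proof. exact: (teval_smooth (TConst a)). Qed.

Lemma smooth_scale (a : R) f : smooth f -> smooth (fun x => f x * a).
Proof.
move=> hf; have := smooth_lincomb a 0 hf hf.
by congr smooth; apply/funext => p; rewrite mul0r addr0 mulrC.
Qed.

Lemma derive_partial f p v : smooth f ->
  'D_v f p = \sum_i xcoord i v * partial i f p.
Proof.
move=> /(@smooth_differentiable _ p) df.
rewrite deriveE // {1}(row_sum_delta v) linear_sum /=.
by apply: eq_bigr => i _; rewrite linearZ /= /partial deriveE.
Qed.

Lemma is_derive_line f p (t : R) : smooth f ->
  is_derive t 1 (fun s : R => f (s *: p))
    (\sum_i xcoord i p * partial i f (t *: p)).
Proof.
move=> hf; rewrite -derive_partial //.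
(* The difference quotients of f(s p) in s at [t] are those of [f] at [t *: p] in the direction
   [p]. *)
have E : (fun h : R => h^-1 *: (((fun s : R => f (s *: p)) \o shift t) (h *: 1) - f (t *: p)))
   = (fun h : R => h^-1 *: ((f \o shift (t *: p)) (h *: p) - f (t *: p))).
  by apply/funext => h /=; rewrite scalerDl [h%:A]mulr1.
have := @smooth_derivable f (t *: p) p hf.
by split; rewrite /derivable /derive E.
Qed.

End SmoothFunctions.

(** * Curvature of constant connections *)

Lemma forall_I2 (P : 'I_2 -> Prop) : P 0 -> P 1 -> forall i, P i.
Proof.
move=> P0 P1 i; have : i \in [:: 0; 1 : 'I_2].
  by case: i => [[|[|]]].
by rewrite !inE => /orP[] /eqP ->.
Qed.

Lemma sum_I2 (V : nmodType) (F : 'I_2 -> V) : \sum_i F i = F 0 + F 1.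
Proof.
rewrite big_ord_recl big_ord1; congr (_ + F _).
exact: val_inj.
Qed.

Lemma I2_01 : ((0 : 'I_2) == 1) = false. Proof. by []. Qed.
Lemma I2_10 : ((1 : 'I_2) == 0) = false. Proof. by []. Qed.
Definition I2E := (I2_01, I2_10, eqxx).

Definition bilin (R : realType) (G : 'I_2 -> 'I_2 -> 'I_2 -> R)
    (v w : 'rV[R]_2) : 'rV[R]_2 :=
  \row_k \sum_i \sum_j xcoord i v * xcoord j w * G i j k.

Section ConstantConnection.
Variables (R : realType) (a b c d e f : R).
Local Notation G := (Gamma_of a b c d e f).
Local Notation nab := (calM a b c d e f).

(** The Ricci tensor in closed form: constant fields commute and have constant covariant
    derivatives, so the curvature is a commutator of multiplication operators, quadratic in the
    symbols. *)
Definition rho_mx : 'M[R]_2 :=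
  \matrix_(i, j)
    if i == j then
      if i == 0 then a * d + b * f - b * c - d ^+ 2
      else a * e - d * e + c * f - c ^+ 2
    else c * d - b * e.

Lemma deriv_along_cst (X : vector_field R) (r : R) :
  deriv_along X (fun=> r) = fun=> 0.
Proof. by apply/funext => p; exact: derive_cst. Qed.

Lemma calM_cst (v w : 'rV[R]_2) :
  nab (fun=> v) (fun=> w) = fun=> bilin G v w.
Proof.
apply/funext => p; apply/rowP => k; rewrite !mxE.
by rewrite (deriv_along_cst _ (xcoord k w)) add0r.
Qed.

Lemma lie_bracket_cst (v w : 'rV[R]_2) :
  lie_bracket (fun=> v) (fun=> w) = fun=> 0.
Proof.
apply/funext => p; apply/rowP => k; rewrite !mxE.
by rewrite (deriv_along_cst _ (xcoord k w)) (deriv_along_cst _ (xcoord k v)) subrr.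
Qed.

Lemma christoffel_calM (i j k : 'I_2) p : christoffel nab i j k p = G i j k.
Proof.
rewrite /christoffel /coord_vf calM_cst /comp_vf /bilin {1}/xcoord mxE.
move: i j k; do 3 apply: forall_I2; rewrite !sum_I2 /xcoord /unit_vec !mxE /=;
  by rewrite ?I2E /=; ring.
Qed.

Lemma ricci_calM p : ricci_mx nab p = rho_mx.
Proof.
apply/matrixP => i j; rewrite !mxE /ricci /curvature /coord_vf.
rewrite /mxtrace.
under eq_bigr do rewrite mxE lie_bracket_cst !calM_cst.
rewrite sum_I2 /xcoord !mxE !sum_I2 /xcoord !mxE !sum_I2 /xcoord /unit_vec !mxE.
by move: i j; do 2 apply: forall_I2; rewrite /Gamma_of /= ?I2E /=; ring.
Qed.

End ConstantConnection.

(** * The solution space Q of a constant connection *)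

Section QuasiEinstein.
Variables (R : realType) (a b c d e f : R).
Local Notation G := (Gamma_of a b c d e f).
Local Notation nab := (calM a b c d e f).
Local Notation rho := (rho_mx a b c d e f).
Implicit Types (h : 'rV[R]_2 -> R) (p : 'rV[R]_2) (t : term R).

Lemma QspaceP h : Qspace nab h <->
  smooth h /\ forall i j p, partial i (partial j h) p =
    \sum_k G i j k * partial k h p - h p * rho i j.
Proof.
have E i j p : \sum_k christoffel nab i j k p * partial k h p =
    \sum_k G i j k * partial k h p.
  by apply: eq_bigr => k _; rewrite christoffel_calM.
split=> -[sh eqh]; split=> // i j p; have := eqh i j p; rewrite ricci_calM E.
  by move=> h0; apply/eqP; rewrite -subr_eq0 opprB addrCA addrC; exact/eqP.
by move=> ->; rewrite addrAC subrK subrr.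
Qed.

(** The equations give the second derivatives in terms of the 1-jet with constant coefficients, so
    along the line from 0 to [p] the 1-jet solves a system covered by [linear_system_zero]. *)
Lemma Qspace_zero h : Qspace nab h ->
  h 0 = 0 -> (forall i, partial i h 0 = 0) -> forall p, h p = 0.
Proof.
move=> /QspaceP[sh eqh] h0 dh0 p.
pose F (i : 'I_3) : 'rV[R]_2 -> R :=
  match val i with 0%N => h | 1%N => partial 0 h | _ => partial 1 h end.
pose al j := \sum_i xcoord i p * rho i j.
pose be j k := \sum_i xcoord i p * G i j k.
(* Row 0 is the derivative of [h] along [p]; rows 1 and 2 are the equations of Q contracted with
   [p]. *)
pose A : 'M[R]_3 := \matrix_(i, j)
  match val i, val j with
  | 0%N, 0%N => 0 | 0%N, 1%N => xcoord 0 p | 0%N, _ => xcoord 1 p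
  | 1%N, 0%N => - al 0 | 1%N, 1%N => be 0 0 | 1%N, _ => be 0 1
  | _, 0%N => - al 1 | _, 1%N => be 1 0 | _, _ => be 1 1
  end.
have sF i : smooth (F i).
  by rewrite /F; case: (val i) => [|[|n]] //; exact: smooth_partial.
have dF i (t : R) : is_derive t 1 (fun s : R => F i (s *: p))
    (\sum_j A i j * F j (t *: p)).
  have dline := is_derive_line p t (sF i).
  apply: is_derive_eq.
  rewrite sum_I2 !big_ord_recl big_ord0 !mxE /F /=.
  case: i {dline} => [[|[|[|//]]]] ? /=; last 2 first.
  - by rewrite !eqh /al /be !sum_I2; ring.
  - by rewrite !eqh /al /be !sum_I2; ring.
  - by rewrite mul0r add0r addr0.
have F0 i : F i (0 *: p) = 0.
  by rewrite scale0r /F; case: (val i) => [|[|n]].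
by have := linear_system_zero dF F0 ord0; rewrite /F /= scale1r.
Qed.

Lemma Qspace_lincomb (x y : R) h1 h2 : Qspace nab h1 -> Qspace nab h2 ->
  Qspace nab (fun p => x * h1 p + y * h2 p).
Proof.
move=> /QspaceP[s1 e1] /QspaceP[s2 e2]; apply/QspaceP.
split=> [|i j p]; first exact: smooth_lincomb.
have dl k : partial k (fun p => x * h1 p + y * h2 p)
    = fun p => x * partial k h1 p + y * partial k h2 p.
  by apply/funext => q; exact: derive_lincomb.
rewrite dl.
transitivity (x * partial i (partial j h1) p + y * partial i (partial j h2) p).
  exact: derive_lincomb (smooth_partial j s1) (smooth_partial j s2).
by rewrite e1 e2 !sum_I2 !dl; ring.
Qed.

Lemma Qspace_teval t :
  (forall i j p, teval (tpartial i (tpartial j t)) p =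
    \sum_k G i j k * teval (tpartial k t) p - teval t p * rho i j) ->
  Qspace nab (teval t).
Proof.
move=> ht; apply/QspaceP; split=> [|i j p]; first exact: teval_smooth.
rewrite !partial_teval ht; congr (_ - _).
by apply: eq_bigr => k _; rewrite partial_teval.
Qed.

(* A solution is determined by its 1-jet at the origin, so three solutions whose
   1-jets there are independent (the determinant below) form a basis. *)
Lemma Qspace_span3 t1 t2 t3 :
  Qspace nab (teval t1) -> Qspace nab (teval t2) -> Qspace nab (teval t3) ->
  (let v t := teval t 0 in
   let v1 t := teval (tpartial 0 t) 0 in
   let v2 t := teval (tpartial 1 t) 0 in
   v t1 * (v1 t2 * v2 t3 - v1 t3 * v2 t2)
   - v t2 * (v1 t1 * v2 t3 - v1 t3 * v2 t1)
   + v t3 * (v1 t1 * v2 t2 - v1 t2 * v2 t1) != 0) ->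
  Qspace nab = span3 (teval t1) (teval t2) (teval t3).
Proof.
move=> Q1 Q2 Q3 /= W; apply/seteqP; split=> h; last first.
  move=> [k1 [k2 [k3 ->]]].
  have := Qspace_lincomb 1 k3 (Qspace_lincomb k1 k2 Q1 Q2) Q3.
  by congr (Qspace nab _); apply/funext => p; rewrite mul1r.
move=> Qh.
have [k1 [k2 [k3 [E0 E1 E2]]]] : exists k1 k2 k3 : R,
  [/\ k1 * teval t1 0 + k2 * teval t2 0 + k3 * teval t3 0 = h 0,
      k1 * teval (tpartial 0 t1) 0 + k2 * teval (tpartial 0 t2) 0
        + k3 * teval (tpartial 0 t3) 0 = partial 0 h 0 &
      k1 * teval (tpartial 1 t1) 0 + k2 * teval (tpartial 1 t2) 0
        + k3 * teval (tpartial 1 t3) 0 = partial 1 h 0].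
  move: W (h 0) (partial 0 h 0) (partial 1 h 0).
  move: (teval t1 0) (teval t2 0) (teval t3 0) => u1 u2 u3.
  move: (teval (tpartial 0 t1) 0) (teval (tpartial 0 t2) 0) (teval (tpartial 0 t3) 0).
  move=> v1 v2 v3.
  move: (teval (tpartial 1 t1) 0) (teval (tpartial 1 t2) 0) (teval (tpartial 1 t3) 0).
  move=> w1 w2 w3.
  set D := (D in D != 0) => D0 x y z.
  (* Cramer's rule for matching the 1-jet of [h] at the origin. *)
  exists ((x * (v2 * w3 - v3 * w2) - u2 * (y * w3 - v3 * z) + u3 * (y * w2 - v2 * z)) / D).
  exists ((u1 * (y * w3 - v3 * z) - x * (v1 * w3 - v3 * w1) + u3 * (v1 * z - y * w1)) / D).
  exists ((u1 * (v2 * z - y * w2) - u2 * (v1 * z - y * w1) + x * (v1 * w2 - v2 * w1)) / D).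
  by split; rewrite /D; field; exact: D0.
pose g p := k1 * teval t1 p + k2 * teval t2 p + k3 * teval t3 p.
have Qg : Qspace nab g.
  have := Qspace_lincomb 1 k3 (Qspace_lincomb k1 k2 Q1 Q2) Q3.
  by congr (Qspace nab _); apply/funext => p; rewrite mul1r.
have dg i : partial i g 0 = k1 * teval (tpartial i t1) 0
    + k2 * teval (tpartial i t2) 0 + k3 * teval (tpartial i t3) 0.
  have -> : g = teval (TAdd (TAdd (TMul (TConst k1) t1) (TMul (TConst k2) t2))
                       (TMul (TConst k3) t3)) by [].
  by rewrite partial_teval /=; ring.
exists k1, k2, k3; apply/funext => p; rewrite -/(g p).
have Qhg := Qspace_lincomb 1 (-1) Qh Qg.
apply/eqP; rewrite -subr_eq0; apply/eqP.
have -> : h p - g p = 1 * h p + -1 * g p by ring.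
apply: (Qspace_zero Qhg).
  by rewrite /g E0; ring.
have [sh _] := Qh; have [sg _] := Qg.
by apply: forall_I2; rewrite /partial derive_lincomb // -!/(partial _ _ _) dg ?E1 ?E2; ring.
Qed.

End QuasiEinstein.

Lemma rank_mx22 (F : fieldType) (A : 'M[F]_2) :
  \rank A = if A 0 0 * A 1 1 - A 0 1 * A 1 0 != 0 then 2%N
           else (A != 0 : nat).
Proof.
have dA : \det A = A 0 0 * A 1 1 - A 0 1 * A 1 0.
  rewrite (expand_det_row _ 0) sum_I2 /cofactor !det_mx11 !mxE /=.
  rewrite (_ : lift 0 0 = 1 :> 'I_2); last exact: val_inj.
  rewrite (_ : lift 1 0 = 0 :> 'I_2); last exact: val_inj.
  by rewrite /= expr0 expr1; ring.
rewrite -dA -unitfE -/(unitmx) ; case: ifPn => [|nA]; first exact: mxrank_unit.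
have [->|A0] := eqVneq A 0; first by rewrite mxrank0.
have : \rank A != 2%N by rewrite -[_ == _]/(row_full A) row_full_unit.
have : \rank A != 0%N by rewrite mxrank_eq0.
by have := rank_leq_row A; case: (\rank A) => [|[|[|]]].
Qed.

(** [w] is a factored form of the determinant, whose nonvanishing is then read off the factors. *)
Ltac rewrite_det_as w :=
  match goal with |- is_true (?x != 0) => (have -> : x = w by ring) end.

(** * Solution spaces and Ricci ranks of the listed models *)

Section Models.
Variable R : realType.
Local Notation C := (@TConst R).
Local Notation X1 := (@TCoord R 0).
Local Notation X2 := (@TCoord R 1).

(** Shaped so that evaluation is convertible to the functions of [Qlist]: squares are products, and
    factors 1 are kept. *)
Definition Qterms (m : model_name R) : term R * term R * term R :=
  match m with
  | M0_0 => (C 1, X1, X2)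
  | M1_0 => (C 1, TExp X1, TMul X2 (TExp X1))
  | M2_0 => (C 1, TExp X2, TExp (TOpp X1))
  | M3_0 => (C 1, X1, TExp X2)
  | M4_0 => (C 1, X2, TAdd (TMul X2 X2) (TMul (C 2) X1))
  | M5_0 => (C 1, TMul (TExp X1) (TCos X2), TMul (TExp X1) (TSin X2))
  | M1_1 => (TMul (TExp X2) (C 1), TMul (TExp X2) X2,
             TMul (TExp X2) (TExp (TOpp X1)))
  | M2_1 c1 => let u := TExp (TMul (C c1) X2) in
      (TMul u (C 1), TMul u (TExp X2), TMul u (TExp (TOpp X1)))
  | M3_1 c1 => let u := TExp (TMul (C c1) X2) in
      (TMul u (C 1), TMul u (TExp X2), TMul u X1)
  | M4_1 c => let u := TExp X2 in
      (TMul u (C 1), TMul u X2,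
       TMul u (TAdd (TMul (C c) (TMul X2 X2)) (TMul (C 2) X1)))
  | M5_1 c => let u := TExp (TMul (C c) X2) in
      (TMul u (TCos X2), TMul u (TSin X2), TExp X1)
  | M1_2 a1 a2 =>
      (TExp X1, TExp X2, TExp (TAdd (TMul (C a1) X1) (TMul (C a2) X2)))
  | M2_2 b1 b2 =>
      (TMul (TExp X1) (TCos X2), TMul (TExp X1) (TSin X2),
       TExp (TAdd (TMul (C b1) X1) (TMul (C b2) X2)))
  | M3_2 c2 => let u := TExp X1 in
      (TMul u (C 1), TMul u (TAdd X1 (TOpp (TMul (C c2) X2))), TMul u (TExp X2))
  | M4_2 s => let u := TExp X1 in
      (u, TMul X2 u, TMul (TAdd (TMul (C 2) X1) (TMul (C s) (TMul X2 X2))) u)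
  end.

Lemma Qlist_Qterms (m : model_name R) : Qlist m =
  span3 (teval (Qterms m).1.1) (teval (Qterms m).1.2) (teval (Qterms m).2).
Proof. by case: m. Qed.

Ltac solve_Qterm :=
  apply: Qspace_teval; apply: forall_I2; apply: forall_I2 => p;
  rewrite sum_I2 /Gamma_of /rho_mx !mxE /= ?I2E /=; first [ring | field; assumption].

(** The determinant of the three 1-jets at the origin is a polynomial in the parameters, [w], since
    exp and cos are 1 and sin is 0 there. *)
Ltac solve_wronskian w :=
  rewrite /= /xcoord !mxE ?I2E ?mulr0 ?addr0 ?oppr0 ?expR0 ?cos0 ?sin0;
  rewrite_det_as w; rewrite ?oppr_eq0 ?pnatr_eq0 ?oner_eq0 //.

Lemma Qspace_model (m : model_name R) : admissible m -> Qspace (model m) = Qlist m.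
Proof.
rewrite Qlist_Qterms.
case: m => [||||||| c1 | c1 | c | c | a1 a2 | b1 b2 | c2 | s] adm;
  rewrite [model _]/= [Qterms _]/= [X in _ = span3 (teval X) _ _]/=
    [X in _ = span3 _ (teval X) _]/= [X in _ = span3 _ _ (teval X)]/=.
- apply: Qspace_span3; [solve_Qterm..|solve_wronskian (1 : R)].
- apply: Qspace_span3; [solve_Qterm..|solve_wronskian (1 : R)].
- apply: Qspace_span3; [solve_Qterm..|solve_wronskian (1 : R)].
- apply: Qspace_span3; [solve_Qterm..|solve_wronskian (1 : R)].
- apply: Qspace_span3; [solve_Qterm..|solve_wronskian (- 2 : R)].
- apply: Qspace_span3; [solve_Qterm..|solve_wronskian (1 : R)].
- apply: Qspace_span3; [solve_Qterm..|solve_wronskian (1 : R)].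
- apply: Qspace_span3; [solve_Qterm..|solve_wronskian (1 : R)].
- apply: Qspace_span3; [solve_Qterm..|solve_wronskian (- 1 : R)].
- apply: Qspace_span3; [solve_Qterm..|solve_wronskian (- 2 : R)].
- apply: Qspace_span3; [solve_Qterm..|solve_wronskian (- 1 : R)].
(* [a1 + a2 - 1] is the denominator of the symbols and, up to sign, the determinant of the
   1-jets. *)
- move: adm => [_ /eqP]; rewrite -subr_eq0 => D0.
  apply: Qspace_span3; [solve_Qterm..|solve_wronskian (- (a1 + a2 - 1) : R)].
- move: adm => [/eqP]; rewrite -subr_eq0 => D0 _.
  apply: Qspace_span3; [solve_Qterm..|solve_wronskian (- (b1 - 1) : R)].
- apply: Qspace_span3; [solve_Qterm..|solve_wronskian (1 : R)].
- apply: Qspace_span3; [solve_Qterm..|solve_wronskian (- 2 : R)].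
Qed.

(** Admissibility keeps the relevant minor of the Ricci matrix nonzero: [c1 * (c1 + 1)] in [M2_1]
    and [M3_1], and in rank 2 a determinant with a closed form. *)
Lemma ricci_has_rank_model (m : model_name R) :
  admissible m -> ricci_has_rank (model m) (nu m).
Proof.
have mx0 (A : 'M[R]_2) : A 0 0 = 0 -> A 0 1 = 0 -> A 1 0 = 0 -> A 1 1 = 0 -> A = 0.
  by move=> h00 h01 h10 h11; apply/matrixP; do 2 apply: forall_I2; rewrite mxE.
have r0 a b c d e f : a * d + b * f - b * c - d ^+ 2 = 0 ->
    c * d - b * e = 0 -> a * e - d * e + c * f - c ^+ 2 = 0 ->
    ricci_has_rank (@calM R a b c d e f) 0.
  move=> h1 h2 h3 p; rewrite ricci_calM [rho_mx _ _ _ _ _ _](_ : _ = 0) ?mxrank0 //.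
  by apply: mx0; rewrite mxE ?I2E.
(* The rank 1 models are normalized so that only the (2,2) entry of the Ricci matrix survives. *)
have r1 a b c d e f : a * d + b * f - b * c - d ^+ 2 = 0 ->
    c * d - b * e = 0 -> a * e - d * e + c * f - c ^+ 2 != 0 ->
    ricci_has_rank (@calM R a b c d e f) 1.
  move=> h1 h2 h3 p; rewrite ricci_calM rank_mx22 !mxE ?I2E h1 h2 !mul0r subrr eqxx /=.
  suff -> : rho_mx a b c d e f != 0 by [].
  by apply: contra_neq h3 => /matrixP /(_ 1 1); rewrite !mxE ?I2E.
have r2 a b c d e f : (a * d + b * f - b * c - d ^+ 2)
    * (a * e - d * e + c * f - c ^+ 2) - (c * d - b * e) ^+ 2 != 0 ->
    ricci_has_rank (@calM R a b c d e f) 2.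
  by move=> h p; rewrite ricci_calM rank_mx22 !mxE ?I2E -expr2 h.
case: m => [||||||| c1 | c1 | c | c | a1 a2 | b1 b2 | c2 | s] adm;
  rewrite [model _]/= [nu _]/=.
- by apply: r0; ring.
- by apply: r0; ring.
- by apply: r0; ring.
- by apply: r0; ring.
- by apply: r0; ring.
- by apply: r0; ring.
- apply: r1; [ring|ring|].
  rewrite (_ : _ - _ = 1) ?oner_eq0 //.
  ring.
- move: adm => [/eqP c10 /eqP]; rewrite -addr_eq0 => c11.
  apply: r1; [ring|ring|].
  rewrite (_ : _ - _ = c1 * (c1 + 1)) ?mulf_neq0 //.
  ring.
- move: adm => [/eqP c10 /eqP]; rewrite -addr_eq0 => c11.
  apply: r1; [ring|ring|].
  rewrite (_ : _ - _ = c1 * (c1 + 1)) ?mulf_neq0 //.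
  ring.
- apply: r1; [ring|ring|].
  rewrite (_ : _ - _ = 1) ?oner_eq0 //.
  ring.
- apply: r1; [ring|ring|].
  have c0 : 0 < 1 + c ^+ 2 by rewrite ltr_wpDr // sqr_ge0.
  rewrite (_ : _ - _ = 1 + c ^+ 2) ?gt_eqF //.
  ring.
- move: adm => [/eqP a0 /eqP]; rewrite -subr_eq0 => D0.
  apply: r2.
  rewrite (_ : _ - _ = - (a1 * a2 / (a1 + a2 - 1))); last by field.
  by rewrite oppr_eq0 mulf_neq0 ?invr_eq0.
- move: adm => [/eqP]; rewrite -subr_eq0 => D0 b0.
  have bb : 0 < b1 ^+ 2 + b2 ^+ 2.
    rewrite lt_neqAle addr_ge0 ?sqr_ge0 // andbT eq_sym paddr_eq0 ?sqr_ge0 //.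
    by rewrite !sqrf_eq0; apply/negP => /andP[/eqP h1 /eqP h2]; apply: b0; rewrite h1 h2.
  apply: r2.
  rewrite (_ : _ - _ = (b1 ^+ 2 + b2 ^+ 2) / (b1 - 1)); last by field.
  by rewrite mulf_neq0 ?invr_eq0 // gt_eqF.
- apply: r2; rewrite (_ : _ - _ = c2); first exact/eqP.
  by ring.
- apply: r2; rewrite (_ : _ - _ = s); last by ring.
  by case: adm => ->; rewrite ?oppr_eq0 oner_eq0.
Qed.

End Models.

(** * Linear equivalence *)

Section Equivalence.
Variable R : realType.

(** Linear equivalence reduced to algebra: [T] is an isomorphism between the products with structure
    constants [G] and [G']. *)
Definition equivG (G G' : 'I_2 -> 'I_2 -> 'I_2 -> R) : Prop :=
  exists2 T : 'M[R]_2, T \in unitmx &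
    forall v w, bilin G' (v *m T) (w *m T) = bilin G v w *m T.

Lemma equivG_trans G1 G2 G3 : equivG G1 G2 -> equivG G2 G3 -> equivG G1 G3.
Proof.
move=> [S uS hS] [T uT hT]; exists (S *m T); first by rewrite unitmx_mul uS.
by move=> v w; rewrite !mulmxA hT hS.
Qed.

Lemma equivG_sym G1 G2 : equivG G1 G2 -> equivG G2 G1.
Proof.
move=> [T uT hT]; exists (invmx T); first by rewrite unitmx_inv.
by move=> v w; rewrite -[bilin G1 _ _](mulmxK uT) -hT !mulmxKV.
Qed.

Definition mx22 (t11 t12 t21 t22 : R) : 'M[R]_2 :=
  \matrix_(i, j)
    if i == 0 then (if j == 0 then t11 else t12)
    else (if j == 0 then t21 else t22).

Lemma mx22_unit t11 t12 t21 t22 :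
  t11 * t22 - t12 * t21 != 0 -> mx22 t11 t12 t21 t22 \in unitmx.
Proof.
move=> D0; rewrite -row_full_unit /row_full rank_mx22 !mxE ?I2E.
by rewrite D0.
Qed.

(** The rows of the matrix are the images of the basis vectors; by symmetry it suffices to compare
    the three products of basis vectors, two coordinates each. *)
Lemma equivG_mx22 (t11 t12 t21 t22 a b c d e f a' b' c' d' e' f' : R) :
  t11 * t22 - t12 * t21 != 0 ->
  a * t11 + b * t21 = t11 ^+ 2 * a' + 2 * t11 * t12 * c' + t12 ^+ 2 * e' ->
  a * t12 + b * t22 = t11 ^+ 2 * b' + 2 * t11 * t12 * d' + t12 ^+ 2 * f' ->
  c * t11 + d * t21 =
    t11 * t21 * a' + (t11 * t22 + t12 * t21) * c' + t12 * t22 * e' ->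
  c * t12 + d * t22 =
    t11 * t21 * b' + (t11 * t22 + t12 * t21) * d' + t12 * t22 * f' ->
  e * t11 + f * t21 = t21 ^+ 2 * a' + 2 * t21 * t22 * c' + t22 ^+ 2 * e' ->
  e * t12 + f * t22 = t21 ^+ 2 * b' + 2 * t21 * t22 * d' + t22 ^+ 2 * f' ->
  equivG (Gamma_of a b c d e f) (Gamma_of a' b' c' d' e' f').
Proof.
move=> D0 h111 h112 h121 h122 h221 h222.
exists (mx22 t11 t12 t21 t22); first exact: mx22_unit.
move=> v w; apply/rowP => k.
rewrite /bilin !mxE !sum_I2 /xcoord !mxE !sum_I2 !mxE ?I2E.
move: (v 0 0) (v 0 1) (w 0 0) (w 0 1) => v0 v1 w0 w1.
have lin (x11 y11 x12 y12 x22 y22 : R) : x11 = y11 -> x12 = y12 -> x22 = y22 ->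
    v0 * w0 * y11 + (v0 * w1 + v1 * w0) * y12 + v1 * w1 * y22 =
    v0 * w0 * x11 + (v0 * w1 + v1 * w0) * x12 + v1 * w1 * x22.
  by move=> -> -> ->.
have := lin _ _ _ _ _ _ h111 h121 h221.
have := lin _ _ _ _ _ _ h112 h122 h222.
move: k; apply: forall_I2; rewrite /Gamma_of /= ?I2E /=.
  by move=> _ E; (etransitivity; [|etransitivity; [exact: E|]]); ring.
by move=> E _; (etransitivity; [|etransitivity; [exact: E|]]); ring.
Qed.

(** The difference quotients on both sides coincide, so differentiability of [f] is not at issue. *)
Lemma derive_mulmx (f : 'rV[R]_2 -> R) (M : 'M[R]_2) p v :
  'D_v (fun q => f (q *m M)) p = 'D_(v *m M) f (p *m M).
Proof.
rewrite /derive.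
by under [in RHS]eq_fun do rewrite /= scalemxAl -mulmxDl.
Qed.

(** The derivative terms match by the chain rule, the quadratic terms by [equivG]. *)
Lemma linearly_equivalent_calM (nabla : operator R) a b c d e f a' b' c' d' e' f' :
  (forall X Y, smooth_vf X -> smooth_vf Y -> nabla X Y = calM a b c d e f X Y) ->
  equivG (Gamma_of a b c d e f) (Gamma_of a' b' c' d' e' f') ->
  linearly_equivalent nabla (calM a' b' c' d' e' f').
Proof.
move=> nE [T uT hT]; exists T => // X Y sX sY; rewrite nE //.
apply/funext => p; apply/rowP => k; rewrite /pushforward !mxE.
have := hT (X (p *m invmx T)) (Y (p *m invmx T)) => /rowP /(_ k).
rewrite [LHS]mxE => ->.
rewrite !mxE !sum_I2 !mxE.
rewrite /deriv_along /comp_vf.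
pose g r := T 0 k * comp_vf Y 0 r + T 1 k * comp_vf Y 1 r.
rewrite (_ : (fun q => _) = fun q => g (q *m invmx T)); last first.
  by apply/funext => q; rewrite /g /comp_vf /xcoord mxE sum_I2 ![T _ k * _]mulrC.
rewrite (derive_mulmx g) mulmxK // derive_lincomb //.
by rewrite /comp_vf; ring.
Qed.

End Equivalence.

(** * Reduction of a Type A connection to its constants *)

Section TypeA.
Variable R : realType.
Variable nabla : operator R.
Hypothesis typeA : typeA_model nabla.

Lemma smooth_coord_vf (i : 'I_2) : smooth_vf (@coord_vf R i).
Proof. by move=> k; exact: smooth_cst. Qed.

Lemma vf_decomp (X : vector_field R) :
  X = add_vf (scale_vf (comp_vf X 0) (coord_vf 0)) (scale_vf (comp_vf X 1) (coord_vf 1)).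
Proof.
apply/funext => p; apply/rowP; apply: forall_I2;
  by rewrite !mxE ?I2E /comp_vf /xcoord ?mulr1 ?mulr0 ?addr0 ?add0r.
Qed.

Lemma smooth_scale_coord (f : 'rV[R]_2 -> R) i :
  smooth f -> smooth_vf (scale_vf f (coord_vf i)).
Proof.
move=> sf k.
rewrite (_ : comp_vf _ k = fun p => f p * xcoord k (unit_vec R i)).
  exact: smooth_scale.
by apply/funext => p; rewrite /comp_vf /xcoord /scale_vf mxE.
Qed.

(** Both fields are expanded in the coordinate frame; linearity in [X] and the Leibniz rule in [Y]
    leave only the constants. *)
Lemma typeA_calM : exists a b c d e f : R,
  forall X Y, smooth_vf X -> smooth_vf Y -> nabla X Y = calM a b c d e f X Y.
Proof.
have [[sm al sl ar lb] tf [G GE]] := typeA.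
(* Coordinate fields commute, so absence of torsion makes the symbols symmetric. *)
have Gsym k : G 0 1 k = G 1 0 k.
  rewrite -(GE 0 1 k 0) -(GE 1 0 k 0) /christoffel /comp_vf /xcoord.
  have := tf (coord_vf 0) (coord_vf 1) 0 (smooth_coord_vf 0) (smooth_coord_vf 1).
  rewrite lie_bracket_cst => /eqP; rewrite subr_eq0 => /eqP ->.
  by [].
exists (G 0 0 0), (G 0 0 1), (G 0 1 0), (G 0 1 1), (G 1 1 0), (G 1 1 1).
move=> X Y sX sY.
have sc := smooth_coord_vf; have ss := smooth_scale_coord.
have Ysum i := ss _ i (sY i).
have Xsum i := ss _ i (sX i).
have nX j : nabla X (coord_vf j) =
    add_vf (scale_vf (comp_vf X 0) (nabla (coord_vf 0) (coord_vf j)))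
           (scale_vf (comp_vf X 1) (nabla (coord_vf 1) (coord_vf j))).
  by rewrite {1}(vf_decomp X) (al _ _ _ (Xsum 0) (Xsum 1) (sc j)) !sl.
rewrite {1}(vf_decomp Y) (ar _ _ _ sX (Ysum 0) (Ysum 1)) !lb // !nX.
apply/funext => p; apply/rowP => k.
have E i j : nabla (coord_vf i) (coord_vf j) p 0 k = G i j k by exact: GE.
rewrite !mxE !sum_I2 !E.
move: k E; apply: forall_I2 => E; rewrite /Gamma_of /= ?I2E -?Gsym.
  by rewrite /deriv_along; ring.
by rewrite /deriv_along; ring.
Qed.

End TypeA.

(** * Classification *)

Section Classification.
Variable R : realType.
Implicit Types (l m k s : R).

Lemma cubic_root (s1 s2 s3 : R) : exists x, x ^+ 3 = s1 * x ^+ 2 - s2 * x + s3.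
Proof.
pose p : {poly R} := 'X^3 - s1 *: 'X^2 + s2 *: 'X - s3%:P.
have pE x : p.[x] = x ^+ 3 - s1 * x ^+ 2 + s2 * x - s3 by rewrite /p !hornerE.
(* At [M] and [- M] the cubic term dominates the lower ones, so the intermediate value theorem
   applies on this interval. *)
pose M := 1 + `|s1| + `|s2| + `|s3|.
have M1 : 1 <= M by rewrite /M -!addrA lerDl !addr_ge0.
have bnd x : `|x| = M -> `|s1 * x ^+ 2 - s2 * x + s3| <= M ^+ 3.
  move=> xM.
  apply: (le_trans (ler_normD _ _)); apply: (le_trans (lerD (ler_normB _ _) (lexx _))).
  rewrite normrM normrX [`|s2 * x|]normrM xM.
  have h1 := normr_ge0 s1; have h2 := normr_ge0 s2; have h3 := normr_ge0 s3.
  have MM : M <= M ^+ 2 by rewrite expr2 ler_peMl // (le_trans ler01).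
  have M11 : 1 <= M ^+ 2 by exact: le_trans MM.
  apply: (@le_trans _ _ (`|s1| * M ^+ 2 + `|s2| * M ^+ 2 + `|s3| * M ^+ 2)).
    by rewrite !lerD // ?ler_wpM2l // ler_peMr.
  by rewrite [leRHS]exprS -!mulrDl ler_wpM2r ?sqr_ge0 // /M; lra.
have M0 : 0 <= M by exact: le_trans M1.
have := bnd M (ger0_norm M0); have := bnd (- M); rewrite normrN ger0_norm // => /(_ erefl).
rewrite !ler_norml => /andP[h1 _] /andP[_ h2].
have [x _ /rootP] : exists2 x, - M <= x <= M & root p x.
  apply: poly_ivt; first lra.
  have E3 : (- M) ^+ 3 = - M ^+ 3 by ring.
  by rewrite !pE E3; apply/andP; split; lra.
by rewrite pE => px; exists x; lra.
Qed.

(** The symbols of the model are recorded because [model] returns an operator while [equivG]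
    compares structure constants. *)
Definition classified (G : 'I_2 -> 'I_2 -> 'I_2 -> R) : Prop :=
  exists2 mo : model_name R, admissible mo &
    exists a b c d e f, model mo = calM a b c d e f /\
      equivG G (Gamma_of a b c d e f).

Lemma classified_equiv G G' : equivG G G' -> classified G' -> classified G.
Proof.
move=> GG' [mo ad [a [b [c [d [e [f [moE G'E]]]]]]]].
exists mo => //; exists a, b, c, d, e, f; split=> //; exact: equivG_trans G'E.
Qed.

(** The vector v = (p, q) and its square (r, s) form a basis, in which the first basis vector
    squares to the second. *)
Lemma equivG_cyclic (p q a b c d e f : R) :
  let r := a * p ^+ 2 + 2 * c * p * q + e * q ^+ 2 in
  let s := b * p ^+ 2 + 2 * d * p * q + f * q ^+ 2 in
  p * s - q * r != 0 ->
  exists c' d' e' f',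
    equivG (Gamma_of a b c d e f) (Gamma_of 0 1 c' d' e' f').
Proof.
move=> r s D0.
have cramer u1 u2 : exists x y : R, x * p + y * r = u1 /\ x * q + y * s = u2.
  exists ((u1 * s - u2 * r) / (p * s - q * r)), ((p * u2 - q * u1) / (p * s - q * r)).
  by split; field; exact: D0.
have [c' [d' [c1 c2]]] := cramer
  (p * r * a + (p * s + q * r) * c + q * s * e)
  (p * r * b + (p * s + q * r) * d + q * s * f).
have [e' [f' [e1 e2]]] := cramer
  (r ^+ 2 * a + 2 * r * s * c + s ^+ 2 * e)
  (r ^+ 2 * b + 2 * r * s * d + s ^+ 2 * f).
exists c', d', e', f'; apply: equivG_sym; apply: (@equivG_mx22 _ p q r s) => //; rewrite /r /s; ring.
Qed.

(* The algebra R[t]/(t^3 - s1 t^2 + s2 t - s3) in the basis 1, t, t^2 - s: the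
   coefficients of t^2, t (t^2 - s) and (t^2 - s)^2 along t and t^2 - s. *)
Definition cubicG (s1 s2 s3 s : R) : 'I_2 -> 'I_2 -> 'I_2 -> R :=
  Gamma_of 0 1 (- (s2 + s)) s1 (s3 - s1 * s2) (s1 ^+ 2 - s2 - 2 * s).

Lemma classify_as (mo : model_name R) (t11 t12 t21 t22 a b c d e f a' b' c' d' e' f' : R) :
  admissible mo -> model mo = calM a' b' c' d' e' f' ->
  t11 * t22 - t12 * t21 != 0 ->
  a * t11 + b * t21 = t11 ^+ 2 * a' + 2 * t11 * t12 * c' + t12 ^+ 2 * e' ->
  a * t12 + b * t22 = t11 ^+ 2 * b' + 2 * t11 * t12 * d' + t12 ^+ 2 * f' ->
  c * t11 + d * t21 =
    t11 * t21 * a' + (t11 * t22 + t12 * t21) * c' + t12 * t22 * e' ->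
  c * t12 + d * t22 =
    t11 * t21 * b' + (t11 * t22 + t12 * t21) * d' + t12 * t22 * f' ->
  e * t11 + f * t21 = t21 ^+ 2 * a' + 2 * t21 * t22 * c' + t22 ^+ 2 * e' ->
  e * t12 + f * t22 = t21 ^+ 2 * b' + 2 * t21 * t22 * d' + t22 ^+ 2 * f' ->
  classified (Gamma_of a b c d e f).
Proof.
move=> ad mE D0 h1 h2 h3 h4 h5 h6; exists mo => //.
exists a', b', c', d', e', f'; split=> //.
exact: (@equivG_mx22 _ t11 t12 t21 t22).
Qed.

Definition cubic_roots l1 l2 l3 s :=
  cubicG (l1 + l2 + l3) (l1 * l2 + l1 * l3 + l2 * l3) (l1 * l2 * l3) s.

Lemma cubic_rootsC l1 l2 l3 s : cubic_roots l1 l2 l3 s = cubic_roots l2 l1 l3 s.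
Proof. by rewrite /cubic_roots; congr (cubicG _ _ _ _); ring. Qed.

Lemma cubic_rootsCA l1 l2 l3 s : cubic_roots l1 l2 l3 s = cubic_roots l2 l3 l1 s.
Proof. by rewrite /cubic_roots; congr (cubicG _ _ _ _); ring. Qed.

(* In the cases below the matrix of the change of basis expresses t and t^2 - s
   in the basis of the target model; it is found by evaluating both on the
   characters (and their derivatives, at a multiple root) of the algebra. *)
Lemma classify_triple l s : classified (cubic_roots l l l s).
Proof.
(* The form with value 1 at 1 and kernel spanned by t and t^2 - s is f(l) - l f'(l) + (l^2 + s)/2
   f''(l). *)
have [s0|s0] := eqVneq (l ^+ 2 + s) 0.
  have -> : s = - l ^+ 2 by apply/eqP; rewrite -addr_eq0 addrC s0.
  have [->|l0] := eqVneq l 0.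
    apply: (@classify_as M4_0 0 1 1 0) => //; [|ring..].
    by rewrite mul0r mulr1 sub0r oppr_eq0 oner_eq0.
  apply: (@classify_as (M4_1 1) 0 l (l ^+ 2) (2 * l ^+ 2)) => //; [|ring..].
  by rewrite mul0r sub0r oppr_eq0 mulf_neq0 // expf_neq0.
(* Rescaling normalizes the weight of f''(l) up to its sign, which becomes the parameter of
   [M4_2]. *)
have [g g0 [sg sg1 gE]] : exists2 g : R, g != 0 &
    exists2 sg : R, sg = 1 \/ sg = -1 & s = - l ^+ 2 - sg * g ^+ 2.
  exists (Num.sqrt `|l ^+ 2 + s|).
    by rewrite sqrtr_eq0 -ltNge normr_gt0.
  rewrite sqr_sqrtr //; case: (ltrP (l ^+ 2 + s) 0) => h.
    by exists 1; [left | rewrite ltr0_norm //; ring].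
  by exists (- 1); [right | rewrite ger0_norm //; ring].
rewrite gE.
apply: (@classify_as (M4_2 sg) l g (l ^+ 2 - s) (2 * l * g)) => //;
  rewrite ?gE; [|by case: sg1 => E; rewrite ?E; ring..].
rewrite_det_as (- (sg * g ^+ 3)).
by rewrite oppr_eq0 mulf_neq0 ?expf_neq0 //; case: sg1 => ->; rewrite ?oppr_eq0 oner_eq0.
Qed.

Lemma classify_double l m s : l != m -> classified (cubic_roots l l m s).
Proof.
rewrite -subr_eq0 -oppr_eq0 opprB => lm.
(* The weight of f'(l) is -(s + l m)/(m - l) and that of f(m) is (s + l^2)/(m - l)^2; if the first
   vanishes, f(l) and f(m) have weights m/(m - l) and -l/(m - l). *)
have [r0|r0] := eqVneq (s + l * m) 0.
  have -> : s = - (l * m) by apply/eqP; rewrite -addr_eq0 r0.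
  have [l0|l0] := eqVneq l 0.
    rewrite l0 subr0 in lm *.
    apply: (@classify_as M3_0 1 m 0 (m ^+ 2)) => //; [|ring..].
    by rewrite mulr0 subr0 mul1r expf_neq0.
  have [->|m0] := eqVneq m 0.
    apply: (@classify_as M1_0 l 1 (l ^+ 2) (2 * l)) => //; [|ring..].
    by rewrite_det_as (l ^+ 2); rewrite expf_neq0.
  apply: (@classify_as (M3_1 (l / (m - l))) 1 (m - l) (2 * l) (m ^+ 2 - l ^+ 2)) => //;
    [| |by field..].
    split; first by apply/eqP; rewrite mulf_neq0 ?invr_eq0.
    move/eqP; rewrite -addr_eq0 => /eqP h; move/eqP: m0; apply.
    have -> : m = (l / (m - l) + 1) * (m - l) by field.
    by rewrite h mul0r.
  by rewrite_det_as ((m - l) ^+ 2); rewrite expf_neq0.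
have [p0|p0] := eqVneq (s + l ^+ 2) 0.
  have sE : s = - l ^+ 2 by apply/eqP; rewrite -addr_eq0 p0.
  have l0 : l != 0 by apply: contra_neq r0 => l0; rewrite sE l0; ring.
  rewrite sE; apply: (@classify_as M1_1 (l - m) l (l ^+ 2 - m ^+ 2) (2 * l ^+ 2)) => //;
    [|ring..].
  by rewrite_det_as (l * (m - l) ^+ 2); rewrite mulf_neq0 ?expf_neq0.
apply: (@classify_as (M3_2 (- (s + l ^+ 2) / (m - l) ^+ 2))
  l (m - l) (l ^+ 2 - s) (m ^+ 2 - l ^+ 2)) => //; [| |by field..].
  by apply/eqP; rewrite mulf_neq0 ?invr_eq0 ?oppr_eq0 ?expf_neq0.
by rewrite_det_as ((m - l) * (s + l * m)); rewrite mulf_neq0.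
Qed.

(** With [s = 0] the form is evaluation at the root 0, whose kernel is an ideal. *)
Lemma classify_distinct_rank0 m n :
  m != 0 -> n != 0 -> m != n -> classified (cubic_roots (0 : R) m n 0).
Proof.
move=> m0 n0; rewrite -subr_eq0 => mn.
apply: (@classify_as M2_0 (- n) m (- n ^+ 2) (m ^+ 2)) => //; [|ring..].
by rewrite_det_as (- (n * m * (m - n))); rewrite oppr_eq0 !mulf_neq0.
Qed.

(** This [s] makes the weight at [l3] vanish; those at [l1] and [l2] are c1 + 1 and -c1 for the
    parameter c1 = l1/(l2 - l1), and rank 0 arises when one of them is 0. *)
Lemma classify_distinct_rank1 l1 l2 l3 :
  l1 != l2 -> l1 != l3 -> l2 != l3 ->
  classified (cubic_roots l1 l2 l3 (- (l1 * l2))).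
Proof.
move=> l12 l13 l23.
have [l10|l10] := eqVneq l1 0.
  move: l12 l13; rewrite l10 mul0r oppr0 ![0 == _]eq_sym => l20 l30.
  exact: classify_distinct_rank0.
have [l20|l20] := eqVneq l2 0.
  rewrite cubic_rootsC; move: l23 l12; rewrite l20 mulr0 oppr0 ![0 == _]eq_sym => l30 _.
  exact: classify_distinct_rank0.
have d21 : l2 - l1 != 0 by rewrite subr_eq0 eq_sym.
have d13 : l1 - l3 != 0 by rewrite subr_eq0.
have d23 : l2 - l3 != 0 by rewrite subr_eq0.
apply: (@classify_as (M2_1 (l1 / (l2 - l1)))
  (l1 - l3) (l2 - l1) (l1 ^+ 2 - l3 ^+ 2) (l2 ^+ 2 - l1 ^+ 2)) => //; [| |by field..].
  split; first by apply/eqP; rewrite mulf_neq0 ?invr_eq0.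
  move/eqP; rewrite -addr_eq0 => /eqP h; move/eqP: l20; apply.
  have -> : l2 = (l1 / (l2 - l1) + 1) * (l2 - l1) by field.
  by rewrite h mul0r.
by rewrite_det_as ((l1 - l3) * (l2 - l1) * (l2 - l3)); rewrite !mulf_neq0.
Qed.

Lemma classify_distinct l1 l2 l3 s :
  l1 != l2 -> l1 != l3 -> l2 != l3 -> classified (cubic_roots l1 l2 l3 s).
Proof.
move=> l12 l13 l23.
have sE x y : s + x * y = 0 -> s = - (x * y) by move/eqP; rewrite addr_eq0 => /eqP.
have [/sE ->|w3] := eqVneq (s + l1 * l2) 0; first exact: classify_distinct_rank1.
have [/sE ->|w1] := eqVneq (s + l2 * l3) 0.
  by rewrite cubic_rootsCA; apply: classify_distinct_rank1; rewrite // eq_sym.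
have [/sE ->|w2] := eqVneq (s + l1 * l3) 0.
  rewrite cubic_rootsC cubic_rootsCA.
  by apply: classify_distinct_rank1; rewrite // eq_sym.
have d12 : l1 - l2 != 0 by rewrite subr_eq0.
have d13 : l1 - l3 != 0 by rewrite subr_eq0.
have d23 : l2 - l3 != 0 by rewrite subr_eq0.
clear l12 l13 l23.
(* If w1, w2, w3 are the weights, then a1 = -w1/w3 and a2 = -w2/w3: on R^2 the value at [l3] is [a1]
   times that at [l1] plus [a2] times that at [l2]. [e1] and [h] state this for t and t^2 - s. *)
pose a1 := - (l2 - l3) * (s + l2 * l3) / ((l1 - l2) * (s + l1 * l2)).
pose a2 := (l1 - l3) * (s + l1 * l3) / ((l1 - l2) * (s + l1 * l2)).
have dw : (l1 - l2) * (s + l1 * l2) != 0 by rewrite mulf_neq0.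
have a1_0 : a1 != 0 by rewrite /a1 !mulf_neq0 ?invr_eq0 ?oppr_eq0 // mulf_neq0.
have a2_0 : a2 != 0 by rewrite /a2 !mulf_neq0 ?invr_eq0 // mulf_neq0.
have D0 : a1 + a2 - 1 != 0.
  have -> : a1 + a2 - 1 = - (l1 - l3) * (l2 - l3) / (s + l1 * l2).
    by rewrite /a1 /a2; field; apply/andP; split.
  by rewrite !mulf_neq0 ?invr_eq0 ?oppr_eq0.
have e1 : l3 = a1 * l1 + a2 * l2.
  by rewrite /a1 /a2; field; apply/andP; split.
have e2 : s = (a1 * l1 ^+ 2 + a2 * l2 ^+ 2 - l3 ^+ 2) / (a1 + a2 - 1).
  have h : l3 ^+ 2 - s = a1 * (l1 ^+ 2 - s) + a2 * (l2 ^+ 2 - s).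
    by rewrite /a1 /a2; field; apply/andP; split.
  apply: (mulIf D0); rewrite mulfVK //; lra.
clearbody a1 a2; clear dw w1 w2 d13 d23.
apply: (@classify_as (M1_2 a1 a2) l1 l2 (l1 ^+ 2 - s) (l2 ^+ 2 - s)) => //.
- split; first by apply/eqP; rewrite mulf_neq0.
  by apply/eqP; rewrite -subr_eq0.
- by rewrite_det_as (- ((l1 - l2) * (s + l1 * l2))); rewrite oppr_eq0 mulf_neq0.
all: clear w3; rewrite e2 e1; field; exact: D0.
Qed.

(* The cubic with roots l and m +- ik. *)
Lemma classify_complex l m k s : k != 0 ->
  classified (cubicG (l + 2 * m) (2 * l * m + (m ^+ 2 + k ^+ 2))
    (l * (m ^+ 2 + k ^+ 2)) s).
Proof.
move=> k0.
have q0 : (l - m) ^+ 2 + k ^+ 2 != 0.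
  by rewrite gt_eqF // ltr_wpDl ?sqr_ge0 // exprn_even_gt0.
(* Up to a nonzero factor this is the weight at the real root [l]. *)
have [w0|w0] := eqVneq (s + (m ^+ 2 + k ^+ 2)) 0.
  have -> : s = - (m ^+ 2 + k ^+ 2) by apply/eqP; rewrite -addr_eq0 w0.
  apply: (@classify_as (M5_1 (m / k)) l k (l ^+ 2 + (m ^+ 2 + k ^+ 2)) (2 * m * k)) => //;
    [|by field..].
  by rewrite_det_as (- (k * ((l - m) ^+ 2 + k ^+ 2))); rewrite oppr_eq0 mulf_neq0.
(* Chosen so that on R^2 one has f(l) = b1 Re f(m + ik) + b2 Im f(m + ik). *)
pose b1 := (2 * m * l - l ^+ 2 + s) / (s + (m ^+ 2 + k ^+ 2)).
pose b2 := (m * (l ^+ 2 - s) - l * (m ^+ 2 - k ^+ 2 - s)) / (k * (s + (m ^+ 2 + k ^+ 2))).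
have D0 : b1 - 1 != 0.
  have -> : b1 - 1 = - ((l - m) ^+ 2 + k ^+ 2) / (s + (m ^+ 2 + k ^+ 2)).
    by rewrite /b1; field.
  by rewrite mulf_neq0 ?invr_eq0 ?oppr_eq0.
have e1 : l = b1 * m + b2 * k.
  by rewrite /b1 /b2; field; apply/andP; split.
have h : l ^+ 2 - s = b1 * (m ^+ 2 - k ^+ 2 - s) + b2 * (2 * m * k).
  by rewrite /b1 /b2; field; apply/andP; split.
clearbody b1 b2.
(* Both vanish when evaluation at [l] is zero on R^2: the rank 0 case, excluded from [M2_2]. *)
have [/andP[/eqP b10 /eqP b20]|bn0] := boolP ((b1 == 0) && (b2 == 0)).
  have l0 : l = 0 by rewrite e1 b10 b20; ring.
  have s0 : s = 0.
    by move: h; rewrite l0 b10 b20 !mul0r addr0 expr0n sub0r => /eqP; rewrite oppr_eq0 => /eqP.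
  rewrite l0 s0.
  apply: (@classify_as M5_0 m k (m ^+ 2 - k ^+ 2) (2 * m * k)) => //; [|ring..].
  rewrite s0 in w0.
  by rewrite_det_as (k * (0 + (m ^+ 2 + k ^+ 2))); rewrite mulf_neq0.
have e2 : s = (b1 * (m ^+ 2 - k ^+ 2) + b2 * (2 * m * k) - l ^+ 2) / (b1 - 1).
  by apply: (mulIf D0); rewrite mulfVK //; lra.
apply: (@classify_as (M2_2 b1 b2) m k (m ^+ 2 - k ^+ 2 - s) (2 * m * k)) => //.
- split; first by apply/eqP; rewrite -subr_eq0.
  by case=> b10 b20; move: bn0; rewrite b10 b20 eqxx.
- by rewrite_det_as (k * (s + (m ^+ 2 + k ^+ 2))); rewrite mulf_neq0.
all: clear w0 h q0; rewrite ?e2 ?e1; first [ring | field; exact: D0].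
Qed.

Lemma classify_cubic s1 s2 s3 s : classified (cubicG s1 s2 s3 s : _ -> _ -> _ -> R).
Proof.
have [l lE] := cubic_root s1 s2 s3.
(* Dividing the cubic by t - l leaves t^2 - u t + w, whose discriminant decides the case. *)
pose u := s1 - l; pose w := s2 - l * u.
have E1 : s1 = l + u by rewrite /u; ring.
have E2 : s2 = w + l * u by rewrite /w; ring.
have E3 : s3 = l * w by rewrite /w /u; move/eqP: lE; rewrite -subr_eq0 => /eqP lE;
  apply/eqP; rewrite -subr_eq0; apply/eqP; rewrite -oppr0 -lE; ring.
have [dn|dp] := ltrP (u ^+ 2 - 4 * w) 0.
  pose k := Num.sqrt (- (u ^+ 2 - 4 * w)) / 2.
  have kk : k ^+ 2 = - (u ^+ 2 - 4 * w) / 4.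
    rewrite /k expr_div_n sqr_sqrtr; last by rewrite oppr_ge0 ltW.
    by congr (_ / _); ring.
  have k0 : k != 0.
    rewrite mulf_neq0 ?invr_eq0 ?pnatr_eq0 // sqrtr_eq0 -ltNge oppr_gt0 //.
  have := classify_complex l (u / 2) s k0; rewrite kk E1 E2 E3.
  by congr (classified (cubicG _ _ _ _)); field.
pose r := Num.sqrt (u ^+ 2 - 4 * w).
have rr : r ^+ 2 = u ^+ 2 - 4 * w by rewrite sqr_sqrtr.
pose m := (u + r) / 2; pose n := (u - r) / 2.
have uE : u = m + n by rewrite /m /n; field.
have wE : w = m * n.
  have -> : m * n = (u ^+ 2 - r ^+ 2) / 4 by rewrite /m /n; field.
  by rewrite rr; field.
have -> : cubicG s1 s2 s3 s = cubic_roots l m n s.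
  by rewrite /cubic_roots E1 E2 E3 uE wE; congr (cubicG _ _ _ _); ring.
have [<-|lm] := eqVneq l m.
  have [<-|ln] := eqVneq l n; first exact: classify_triple.
  exact: classify_double.
have [<-|ln] := eqVneq l n.
  by rewrite cubic_rootsCA cubic_rootsCA; apply: classify_double.
have [<-|mn] := eqVneq m n; last exact: classify_distinct.
by rewrite cubic_rootsCA; apply: classify_double; rewrite eq_sym.
Qed.

(** In the cyclic basis the four free symbols determine s1, s2, s3 and s, so every such product has
    the form [cubicG]. *)
Lemma classify_cyclic (p q a b c d e f : R) :
  p * (b * p ^+ 2 + 2 * d * p * q + f * q ^+ 2)
  - q * (a * p ^+ 2 + 2 * c * p * q + e * q ^+ 2) != 0 ->
  classified (Gamma_of a b c d e f).
Proof.
move=> /equivG_cyclic[c' [d' [e' [f' GG']]]]; apply: (classified_equiv GG').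
have := classify_cubic d' (f' - 2 * c' - d' ^+ 2)
  (e' + d' * (f' - 2 * c' - d' ^+ 2)) (c' + d' ^+ 2 - f').
by congr classified; rewrite /cubicG; congr Gamma_of; ring.
Qed.

(* Here Gamma(x, y) = l(x) y + l(y) x with l = (d, c), so that Gamma(x, x) is
   always a multiple of x. *)
Lemma classify_noncyclic (c d : R) :
  classified (Gamma_of (2 * d) 0 c d 0 (2 * c)).
Proof.
have [d0|d0] := eqVneq d 0.
  have [c0|c0] := eqVneq c 0.
    rewrite d0 c0; apply: (@classify_as M0_0 1 0 0 1) => //; [|ring..].
    by rewrite mulr1 mulr0 subr0 oner_eq0.
  (* In [M4_1 0] the linear form is the second coordinate, so the second column of the matrix must
     be (d, c), here and below. *)
  rewrite d0; apply: (@classify_as (M4_1 0) 1 0 0 c) => //; [|ring..].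
  by rewrite mul1r mulr0 subr0.
apply: (@classify_as (M4_1 0) 0 d 1 c) => //; [|ring..].
by rewrite mul0r mulr1 sub0r oppr_eq0.
Qed.

(** The determinant of v and Gamma(v, v) is a binary cubic form in v; if it vanishes at (1,0),
    (0,1), (1,1) and (1,-1), it is zero, which gives the noncyclic symbols. *)
Lemma classify_all (a b c d e f : R) : classified (Gamma_of a b c d e f).
Proof.
have [b0|b0] := eqVneq b 0; last first.
  by apply: (@classify_cyclic 1 0); rewrite_det_as b.
have [e0|e0] := eqVneq e 0; last first.
  by apply: (@classify_cyclic 0 1); rewrite_det_as (- e); rewrite oppr_eq0.
have [h1|h1] := eqVneq ((b + 2 * d + f) - (a + 2 * c + e)) 0; last first.
  by apply: (@classify_cyclic 1 1); rewrite_det_as ((b + 2 * d + f) - (a + 2 * c + e)).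
have [h2|h2] := eqVneq ((b - 2 * d + f) + (a - 2 * c + e)) 0; last first.
  by apply: (@classify_cyclic 1 (- 1)); rewrite_det_as ((b - 2 * d + f) + (a - 2 * c + e)).
have aE : a = 2 * d by move: h1 h2; rewrite b0 e0; lra.
have fE : f = 2 * c by move: h1 h2; rewrite b0 e0; lra.
rewrite aE b0 e0 fE; exact: classify_noncyclic.
Qed.

End Classification.

Theorem theorem3p3 (R : realType) :
  (forall nabla : operator R, typeA_model nabla ->
     exists2 m : model_name R,
       admissible m & linearly_equivalent nabla (model m))
  /\
  (forall m : model_name R, admissible m ->
     Qspace (model m) = Qlist m /\ ricci_has_rank (model m) (nu m)).
Proof.
split=> [nabla tA|m adm]; last first.
  by split; [exact: Qspace_model | exact: ricci_has_rank_model].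
have [a [b [c [d [e [f nablaE]]]]]] := typeA_calM tA.
have [m adm [a' [b' [c' [d' [e' [f' [mE GG']]]]]]]] := classify_all a b c d e f.
by exists m => //; rewrite mE; exact: linearly_equivalent_calM nablaE GG'.
Qed.
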